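(* For every bounded, separable, pointed metric space $(X,d,p)$ with finite Nagata dimension (dimension $n\in\mathbb{N}$ with constant $\gamma<\infty$) and every $\alpha \in (0,1)$, the pointed space $(X,d^\alpha,p)$ admits a stochastic biLipschitz embedding of distortion $D<\infty$ into a bounded, separable, pointed ultrametric space, where $D$ depends only on $n,\gamma,\alpha$.
   Context: A metric space $X$ has Nagata dimension $n\in\mathbb{N}=\{0,1,2,\dots\}$ with constant $\gamma<\infty$ if for every $s>0$ there is a cover $\mathcal{C}$ of $X$ such that $\mathrm{diam}(C)\le\gamma s$ for all $C\in\mathcal{C}$ and every $A\subseteq X$ with $\mathrm{diam}(A)\le s$ meets at most $n+1$ members of $\mathcal{C}$. $d^\alpha(x,y):=d(x,y)^\alpha$. A pointed metric space is a metric space with a distinguished basepoint. A random map $\phi=\{\phi_\omega:X\to Y\}_{\omega\in\Omega}$ between pointed metric spaces $(X,d_X,x_0)$, $(Y,d_Y,y_0)$ is a family of maps indexed by a probability space $(\Omega,\mathcal{F},\mathbb{P})$ such that: for every $x\in X$, $\omega\mapsto\phi_\omega(x)$ is measurable (Borel $\sigma$-algebra on $Y$); for every $x\in X$ there are a separable $S\subseteq Y$ and a $\mathbb{P}$-null set $N$ with $\phi_\omega(x)\in S$ for all $\omega\in\Omega\setminus N$; and $\phi_\omega(x_0)=y_0$ for almost every $\omega$. It is a stochastic biLipschitz embedding of distortion $D<\infty$ if there is a scaling factor $s\in(0,\infty)$ such that for all $x,y\in X$: $\mathbb{E}_\omega[d_Y(\phi_\omega(x),\phi_\omega(y))]\le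 sD\,d_X(x,y)$, and $d_Y(\phi_\omega(x),\phi_\omega(y))\ge s\,d_X(x,y)$ for almost every $\omega$. An ultrametric space is a metric space with $d(u,w)\le\max\{d(u,v),d(v,w)\}$ for all $u,v,w$. *)

(* Defs.v *)
From HB Require Import structures.
From mathcomp Require Import all_boot all_order all_algebra.
From mathcomp Require Import all_classical all_reals all_analysis.

Set Implicit Arguments.
Unset Strict Implicit.
Unset Printing Implicit Defensive.

Import Order.TTheory GRing.Theory Num.Theory.

Local Open Scope classical_set_scope.
Local Open Scope ring_scope.

(* The point 0 is added to the set of distances so that diam set0 = 0; the
   supremum of an empty subset of \bar R would be -oo. *)
Definition diam (R : realType) (X : metricType R) (A : set X) : \bar R :=
  ereal_sup (0%E |` [set (mdist z.1 z.2)%:E | z in A `*` A]).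

Definition bounded_space (R : realType) (X : metricType R) : Prop :=
  (diam [set: X] < +oo)%E.

Definition separable_set (T : topologicalType) (S : set T) : Prop :=
  exists C : set T, [/\ countable C, C `<=` S & S `<=` closure C].

Definition separable_space (T : topologicalType) : Prop :=
  separable_set [set: T].

Definition ultrametric (R : realType) (Y : metricType R) : Prop :=
  forall u v w : Y, mdist u w <= Num.max (mdist u v) (mdist v w).

Definition nagata_dimension (R : realType) (X : metricType R)
    (n : nat) (gamma : R) : Prop :=
  forall s : R, 0 < s -> exists C : set (set X),
    [/\ cover C id = [set: X],
        forall B, C B -> (diam B <= (gamma * s)%:E)%E
      & forall A : set X, (diam A <= s%:E)%E ->
          ([set B | C B /\ A `&` B !=set0] #<= `I_n.+1)%card].

Lemma snowflake_triangle (R : realType) (a x y z : R) :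
  0 < a < 1 -> 0 <= x -> 0 <= y -> 0 <= z -> z <= x + y ->
  z `^ a <= x `^ a + y `^ a.
Proof.
move=> /andP[a0 a1] x0 y0 z0 zxy.
have [xE|xN0] := eqVneq x 0.
  rewrite xE powR0 ?gt_eqF// add0r; apply: ge0_ler_powR; rewrite ?nnegrE ?(ltW a0)//.
  by move: zxy; rewrite xE add0r.
have xp : 0 < x by rewrite lt_neqAle eq_sym xN0.
have s0 : 0 < x + y by rewrite ltr_wpDr.
apply: (@le_trans _ _ ((x + y) `^ a)).
  by apply: ge0_ler_powR; rewrite ?nnegrE ?(ltW a0) ?(ltW s0).
have part (t : R) : 0 <= t -> t <= x + y -> t / (x + y) * (x + y) `^ a <= t `^ a.
  rewrite le_eqVlt => /predU1P[<- _|tp ts]; first by rewrite mul0r mul0r powR_ge0.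
  rewrite -[in leRHS](@divfK _ (x + y) _ t) ?gt_eqF//.
  rewrite powRM ?divr_ge0 ?(ltW tp) ?(ltW s0)// ler_wpM2r ?powR_ge0//.
  by apply: ger1_powR; rewrite ?divr_gt0 ?ler_pdivrMr ?mul1r//= (ltW a1).
have -> : (x + y) `^ a = x / (x + y) * (x + y) `^ a + y / (x + y) * (x + y) `^ a.
  by rewrite -!mulrDl divff ?mul1r// gt_eqF.
by apply: lerD; apply: part => //; rewrite ?lerDl ?lerDr.
Qed.

(* snowflake X ha is the space (X, d^a); ha is carried by the type so that d^a
   can be declared as its metric structure. *)
Definition snowflake (R : realType) (X : metricType R) (a : R)
  (ha : 0 < a < 1) : Type := X.

Section snowflake_metric.
Context (R : realType) (X : metricType R) (a : R) (ha : 0 < a < 1).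
Local Notation snow := (snowflake X ha).

HB.instance Definition _ := Choice.on snow.

Definition snowflake_dist (x y : snow) : R :=
  (@mdist R X x y) `^ a.

Lemma snowflake_distxx x : snowflake_dist x x = 0.
Proof.
by case/andP: ha => a0 _; rewrite /snowflake_dist mdistxx powR0// gt_eqF.
Qed.

Lemma snowflake_dist_positivity x y : snowflake_dist x y = 0 -> x = y.
Proof. by move=> /powR_eq0_eq0 /mdist_positivity. Qed.

Lemma snowflake_dist_sym x y : snowflake_dist x y = snowflake_dist y x.
Proof. by rewrite /snowflake_dist metric_sym. Qed.

Lemma snowflake_dist_triangle y x z :
  snowflake_dist x z <= snowflake_dist x y + snowflake_dist y z.
Proof.
by apply: snowflake_triangle; rewrite ?mdist_ge0//; exact: metric_triangle.
Qed.

HB.instance Definition _ := isMetric.Build R snow snowflake_distxx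
  snowflake_dist_positivity snowflake_dist_sym snowflake_dist_triangle.

Lemma snowflakeE (x y : snow) : mdist x y = (@mdist R X x y) `^ a.
Proof. by []. Qed.

End snowflake_metric.

Section random_maps.
Context (R : realType) (d : measure_display) (Omega : measurableType d)
  (P : probability Omega R) (X Y : metricType R).

(* <<s open >> is the Borel sigma-algebra of Y. *)
Definition random_map (x0 : X) (y0 : Y) (phi : Omega -> X -> Y) : Prop :=
  [/\ forall (x : X) (B : set Y), <<s (@open Y) >> B ->
        measurable [set w | B (phi w x)],
      forall x : X, exists (S : set Y) (N : set Omega),
        [/\ separable_set S, P.-negligible N
          & forall w, ~ N w -> S (phi w x)]
    & {ae P, forall w, phi w x0 = y0}].

Definition stochastic_biLipschitz (D : R) (phi : Omega -> X -> Y) : Prop :=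
  exists2 s : R, 0 < s & forall x y : X,
    ('E_P[fun w => mdist (phi w x) (phi w y)] <= (s * D * mdist x y)%:E)%E /\
    {ae P, forall w, s * mdist x y <= mdist (phi w x) (phi w y)}.

End random_maps.

Definition admits_stochastic_embedding (R : realType) (X : metricType R)
    (x0 : X) (Y : metricType R) (y0 : Y) (D : R) : Prop :=
  exists (d : measure_display) (Omega : measurableType d)
         (P : probability Omega R) (phi : Omega -> X -> Y),
    random_map P x0 y0 phi /\ stochastic_biLipschitz P D phi.

Arguments admits_stochastic_embedding {R} X x0 Y y0 D.

(* Main.v *)
Require Import Defs.
From HB Require Import structures.
From mathcomp Require Import all_boot all_order all_algebra.
From mathcomp Require Import all_classical all_reals all_analysis.
From mathcomp Require Import measurable_realfun.
From mathcomp Require Import ring lra.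
Import Order.TTheory GRing.Theory Num.Theory.
Local Open Scope classical_set_scope.
Local Open Scope ring_scope.

Set Implicit Arguments.
Unset Strict Implicit.
Unset Printing Implicit Defensive.

(** The target is Baire space: integer sequences at distance b ^+ m, where m is
    the first index at which they differ and b = 2^-alpha.  A point of X
    is sent to the sequence of labels of the clusters containing it in random
    partitions of X, one for each scale s_k proportional to 2^-k.  All these
    partitions can share one random parameter t, uniform in [0, 1], because the
    estimates only add up expectations.

    At a scale s, enumerate a Nagata cover C_0, C_1, ... and let t inflate its
    members: the label of x is the least j with d(x, C_j) < t * s / 2.  Points
    with the same label are near a common member, hence at distance at most
    (gamma + 1) * s.  Points x, y with different labels are told apart by some
    C_j, that is, t * s / 2 lies between d(x, C_j) and d(y, C_j); this confines t
    to an interval of length at most 2 * d(x, y) / s, and C_j meets the ball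
    of radius s / 2 around x or y, which leaves at most 2 * (n + 1) sets C_j.
    Hence the labels differ with probability at most
    4 * (n + 1) * d(x, y) / s ([random_partition]).

    Let x, y be at distance r, and let s_K be the first scale at which the bound
    on the diameter of clusters falls below r.  The labels at scale K differ
    for almost every t, so the distance of the images is at least b ^+ K, which
    is comparable to r^alpha, up to a factor depending on the size of X that the
    scaling factor of the embedding absorbs: this is the lower bound.  For the
    upper bound, the distance of the images is at most b ^+ K unless the labels
    differ at some k < K, so
      E <= b ^+ K + \sum_(k < K) b ^+ k * (const * r / s_k),
    and the sum is geometric with ratio 2 * b = 2^(1 - alpha) > 1, hence
    comparable to its last term, which is again comparable to b ^+ K
    ([upper_estimate]): this is where alpha < 1 enters. *)

(** * First index satisfying a predicate *)

(** The default value 0 makes this total, so that equal predicates give equal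
    indices without any existence proof: labels can only differ when two
    predicates differ somewhere. *)
Definition first_index (Q : pred nat) : nat :=
  if pselect (exists j, Q j) is left ex then ex_minn ex else 0%N.

Lemma first_indexP (Q : pred nat) j : Q j -> Q (first_index Q).
Proof.
by rewrite /first_index; case: pselect => [ex _|nex Qj];
  [case: ex_minnP|case: nex; exists j].
Qed.

Lemma first_index_min (Q : pred nat) j : Q j -> (first_index Q <= j)%N.
Proof.
rewrite /first_index; case: pselect => [ex|//]; case: ex_minnP => m _; exact.
Qed.

Lemma first_index_none (Q : pred nat) : (forall j, ~~ Q j) -> first_index Q = 0%N.
Proof.
by rewrite /first_index; case: pselect => // -[j Qj] /(_ j)/negP.
Qed.

Lemma measurable_first_index d (Omega : measurableType d)
    (Q : nat -> Omega -> bool) (j : nat) :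
  (forall i, measurable [set w | Q i w]) ->
  measurable [set w | first_index (Q^~ w) = j].
Proof.
move=> mQ.
pose none i := ~` [set w | Q i w].
have mnone i : measurable (none i) by exact: measurableC.
rewrite (_ : [set w | _] =
    ([set w | Q j w] `&` \bigcap_(i in `I_j) none i) `|`
    (if j == 0%N then \bigcap_i none i else set0)).
  apply: measurableU; last first.
    by case: ifP => // _; apply: bigcapT_measurable => k.
  by apply: measurableI => //; apply: bigcap_measurableType => k _.
apply/seteqP; split => w /=.
  have [[i Qi]|nQ] := pselect (exists i, Q i w).
    move=> <-; left; split; first exact: (@first_indexP (Q^~ w) i).
    move=> k /= kj; apply/negP; apply: contraTN kj => Qk.
    by rewrite -leqNgt; exact: (@first_index_min (Q^~ w)).
  have noQ i : ~~ Q i w by apply/negP => Qi; apply: nQ; exists i.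
  rewrite first_index_none// => <-; right => i _ /=; exact/negP.
case=> [[Qj minj]|].
  apply/eqP; rewrite eqn_leq; apply/andP; split.
    exact: (@first_index_min (Q^~ w)).
  rewrite leqNgt; apply/negP => /minj; apply.
  exact: (@first_indexP (Q^~ w) j).
case: eqP => // -> noQ; apply: first_index_none => i; apply/negP; exact: noQ.
Qed.

(** * Baire space as an ultrametric space *)

(** The base b and the proof that it lies in ]0, 1[ are carried by the type
    because the metric depends on them. *)
Definition baire (R : realType) (b : R) (hb : 0 < b < 1) : Type := nat -> nat.

Section baire_metric.
Context (R : realType) (b : R) (hb : 0 < b < 1).
Local Notation Y := (baire hb).

HB.instance Definition _ := Choice.copy Y (nat -> nat).

Implicit Types u v w : Y.

Definition baire_dist u v : R :=
  if u == v then 0 else b ^+ first_index (fun k => u k != v k).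

Let b0 : 0 < b. Proof. by case/andP: hb. Qed.
Let b1 : b <= 1. Proof. by case/andP: hb => _ /ltW. Qed.

Lemma baire_distxx u : baire_dist u u = 0.
Proof. by rewrite /baire_dist eqxx. Qed.

Lemma baire_dist_positivity u v : baire_dist u v = 0 -> u = v.
Proof.
by rewrite /baire_dist; case: eqVneq => // _ /eqP; rewrite expf_eq0 gt_eqF ?andbF.
Qed.

Lemma baire_dist_sym u v : baire_dist u v = baire_dist v u.
Proof.
rewrite /baire_dist eq_sym; congr (if _ then _ else _ ^+ first_index _).
by apply/funext => k; rewrite eq_sym.
Qed.

Lemma baire_dist_ge0 u v : 0 <= baire_dist u v.
Proof. by rewrite /baire_dist; case: ifP => // _; exact/exprn_ge0/ltW. Qed.

Lemma first_difference u v : u != v ->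
  let m := first_index (fun k => u k != v k) in
  u m != v m /\ baire_dist u v = b ^+ m.
Proof.
move=> uv; split; last by rewrite /baire_dist (negbTE uv).
have [[k uvk]|nuv] := pselect (exists k, u k != v k).
  exact: (@first_indexP (fun k => u k != v k) k).
case/eqP: uv; apply/funext => k; apply/eqP; apply: contra_notT nuv => uvk.
by exists k.
Qed.

Lemma baire_dist_ge u v k : u k != v k -> b ^+ k <= baire_dist u v.
Proof.
move=> uvk; have uv : u != v by apply: contraNneq uvk => ->.
have [_ ->] := first_difference uv.
rewrite ler_wiXn2l ?(ltW b0)//.
exact: (@first_index_min (fun k => u k != v k)).
Qed.

(** At the first index where u and w differ, v differs from one of them. *)
Lemma baire_dist_ultra u v w :
  baire_dist u w <= Num.max (baire_dist u v) (baire_dist v w).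
Proof.
have [->|uw] := eqVneq u w.
  by rewrite baire_distxx le_max baire_dist_ge0.
have [uwm ->] := first_difference uw.
set m := first_index _ in uwm *; rewrite le_max.
have [uvm|uvm] := eqVneq (u m) (v m); last by rewrite baire_dist_ge.
by apply/orP; right; apply: baire_dist_ge; rewrite -uvm.
Qed.

Lemma baire_dist_triangle v u w :
  baire_dist u w <= baire_dist u v + baire_dist v w.
Proof.
apply: (le_trans (baire_dist_ultra u v w)).
by rewrite ge_max lerDl lerDr !baire_dist_ge0.
Qed.

HB.instance Definition _ := isMetric.Build R Y baire_distxx
  baire_dist_positivity baire_dist_sym baire_dist_triangle.

Lemma baire_ultrametric : ultrametric Y.
Proof. exact: baire_dist_ultra. Qed.

Lemma baire_mdist_ge u v k : u k != v k -> b ^+ k <= mdist u v.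
Proof. exact: baire_dist_ge. Qed.

Lemma baire_mdist_first_difference u v : u <> v ->
  exists m, u m != v m /\ mdist u v = b ^+ m.
Proof. move=> /eqP/first_difference uv; by eexists; exact: uv. Qed.

Lemma baire_bounded : bounded_space Y.
Proof.
apply: (@le_lt_trans _ _ 1%E); last exact: ltry.
apply: ge_ereal_sup => _ [->|/= [[u v] _ <-]]; first exact: lee01.
rewrite lee_fin; have [->|/eqP/baire_mdist_first_difference[m [_ ->]]] := eqVneq u v.
  by rewrite mdistxx.
by rewrite exprn_ile1// ltW.
Qed.

Lemma expr_lt_eps (e : R) : 0 < e -> exists k, b ^+ k < e.
Proof.
move=> e0; have /cvgrPdist_lt/(_ e e0)[k _ /(_ k (leqnn k))] :=
  @cvg_expr R b ltac:(by rewrite gtr0_norm//; case/andP: hb).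
rewrite /= sub0r normrN gtr0_norm ?exprn_gt0// => bk.
by exists k.
Qed.

Definition cylinder (s : seq nat) : set Y :=
  [set u | forall i, (i < size s)%N -> u i = nth 0%N s i].

Lemma cylinder_mdist s u v : cylinder s u -> cylinder s v ->
  mdist u v <= b ^+ size s.
Proof.
move=> us vs; have [->|/eqP/baire_mdist_first_difference[m [uvm ->]]] := eqVneq u v.
  by rewrite mdistxx exprn_ge0// ltW.
rewrite ler_wiXn2l ?(ltW b0)// leqNgt; apply: contraNN uvm => ms.
by rewrite us// vs.
Qed.

Lemma cylinder_mkseq u k : cylinder (mkseq u k) u.
Proof. by move=> i; rewrite size_mkseq => ik; rewrite nth_mkseq. Qed.

Lemma cylinder_nth s : cylinder s (nth 0%N s).
Proof. by []. Qed.

(** Cylinders form a countable base: this gives separability and reduces Borel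
    measurability to that of the coordinates. *)
Lemma nbhs_cylinder u (B : set Y) : nbhs u B -> exists k, cylinder (mkseq u k) `<=` B.
Proof.
rewrite -nbhs_ballE => -[e /= e0 eB].
have [k bke] := expr_lt_eps e0; exists k => v vu; apply: eB.
rewrite ballEmdist /=; apply: le_lt_trans bke.
by have := cylinder_mdist (@cylinder_mkseq u k) vu; rewrite size_mkseq.
Qed.

Lemma baire_separable : separable_space Y.
Proof.
exists (range (nth 0%N : seq nat -> Y)); split => //.
  by apply: sub_countable (card_image_le _ _) _; exact: countableP.
move=> u _ B /nbhs_cylinder[k ukB].
exists (nth 0%N (mkseq u k)); split; first by exists (mkseq u k).
exact/ukB/cylinder_nth.
Qed.

Lemma baire_borel_measurable d (Omega : measurableType d) (f : Omega -> Y) :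
  (forall k j, measurable [set w | f w k = j]) ->
  forall B : set Y, <<s (@open Y) >> B -> measurable [set w | B (f w)].
Proof.
move=> mf B sB.
suff : image_set_system setT f measurable B.
  by rewrite /image_set_system/= setTI.
apply: sB; split; first by apply: sigma_algebra_image; exact: sigma_algebra_measurable.
move=> U oU; rewrite /image_set_system/= setTI.
rewrite (_ : f @^-1` U = \bigcup_(s : seq nat)
    (if `[< cylinder s `<=` U >] then [set w | cylinder s (f w)] else set0)).
  apply: countable_bigcupT_measurable => // s; case: ifP => // _.
  rewrite (_ : [set w | _] =
      \bigcap_(i in `I_(size s)) [set w | f w i = nth 0%N s i])//.
  by apply: bigcap_measurableType => k _.
apply/seteqP; split => w /=.
  move=> Ufw; have /nbhs_cylinder[k kU] := open_nbhs_nbhs (conj oU Ufw).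
  by exists (mkseq (f w) k) => //; rewrite asboolT//; exact: cylinder_mkseq.
by case=> s _; case: ifPn => // /asboolP sU /sU.
Qed.

End baire_metric.

(** * Diameters and distances to a set *)

Lemma diam_le (R : realType) (X : metricType R) (A : set X) (r : R) :
  0 <= r -> (diam A <= r%:E)%E <-> {in A &, forall x y, mdist x y <= r}.
Proof.
move=> r0; split=> [Ar x y /set_mem Ax /set_mem Ay|Ar].
  rewrite -lee_fin; apply: le_trans Ar; apply: ereal_sup_ubound.
  by right; exists (x, y).
apply: ge_ereal_sup => _ [->|/= [[x y] [/= Ax Ay] <-]]; rewrite lee_fin//.
by apply: Ar; exact/mem_set.
Qed.

Section distance_to_set.
Context (R : realType) (X : metricType R).
Implicit Types (x y : X) (B : set X).

Definition set_dist B x : R := inf [set mdist x z | z in B].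

Let has_lb B x : has_lbound [set mdist x z | z in B].
Proof. by exists 0 => _ [z _ <-]; exact: mdist_ge0. Qed.

Lemma set_dist_lt B x r : B !=set0 -> set_dist B x < r ->
  exists2 z, B z & mdist x z < r.
Proof.
move=> [z Bz] /inf_lt[]; first by exists (mdist x z), z.
by move=> _ [y By <-] xyr; exists y.
Qed.

Lemma set_dist_le B x z : B z -> set_dist B x <= mdist x z.
Proof. by move=> Bz; apply: ge_inf; [exact: has_lb|exists z]. Qed.

Lemma set_dist_lip B x y : B !=set0 -> set_dist B y <= set_dist B x + mdist x y.
Proof.
move=> B0; rewrite -lerBlDr; apply: lb_le_inf.
  by case: B0 => z Bz; exists (mdist x z), z.
move=> _ [z Bz <-]; rewrite lerBlDr; apply: le_trans (set_dist_le y Bz) _.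
by rewrite addrC (metric_sym x y) metric_triangle.
Qed.

End distance_to_set.

(** * Enumerating a Nagata cover *)

Section cover_enumeration.
Context (R : realType) (X : metricType R) (n : nat) (gamma s : R) (p : X).
Hypotheses (s0 : 0 < s) (sepX : separable_space X).

(** The closed ball of radius s / 2 has diameter at most s, so the Nagata
    condition bounds the number of these members by n + 1. *)
Definition near_members (C : set (set X)) x : set (set X) :=
  [set B | C B /\ exists2 z, B z & mdist x z <= s / 2].

Lemma cover_near_members : nagata_dimension X n gamma ->
  exists C : set (set X),
  [/\ forall x, exists2 B, C B & B x,
      forall B x y, C B -> B x -> B y -> mdist x y <= gamma * s
    & forall x, (near_members C x #<= `I_n.+1)%card].
Proof.
move=> /(_ s s0)[C [covC diamC meetC]]; exists C; split.
- by move=> x; have : [set: X] x by []; rewrite -covC => -[B CB Bx]; exists B.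
- move=> B x y /diamC diamB Bx By; rewrite -lee_fin; apply: le_trans diamB.
  by apply: ereal_sup_ubound; right; exists (x, y).
move=> x; pose A := [set z | mdist x z <= s / 2].
have diamA : (diam A <= s%:E)%E.
  apply/diam_le; first exact: ltW.
  move=> y z /set_mem/= xy /set_mem/= xz; rewrite (splitr s).
  by apply: le_trans (metric_triangle y x z) _; rewrite lerD// metric_sym.
apply: card_le_trans (meetC A diamA); apply: subset_card_le => B [CB [z Bz xz]].
by split => //; exists z.
Qed.

(** A nonempty member is within s / 2 of a point of a countable dense set, and
    only finitely many members are near each such point. *)
Lemma countable_members (C : set (set X)) :
  (forall x, (near_members C x #<= `I_n.+1)%card) ->
  countable [set B | C B /\ B !=set0].
Proof.
case: sepX => S [cS _ clS] nearC.
apply: (@sub_countable _ _ _ (\bigcup_(q in S) near_members C q)); last first.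
  apply: bigcup_countable => // q _.
  exact/finite_set_countable/(card_le_finite (nearC q)).
apply: subset_card_le => B [CB [z Bz]].
have h0 : 0 < s / 2 by rewrite divr_gt0.
have [q [Sq zq]] := clS z I _ (nbhsx_ballx z _ h0).
exists q => //; split => //; exists z => //.
by move: zq; rewrite ballEmdist /= metric_sym => /ltW.
Qed.

(** A member containing p is put first, so that p always gets label 0.  The
    enumeration may repeat members, so near members are counted as sets, by the
    finite family g, and not as indices. *)
Lemma cover_enumeration : nagata_dimension X n gamma ->
  exists e : nat -> set X,
  [/\ forall x, exists j, e j x,
      e 0%N p,
      forall j, e j !=set0,
      forall j x y, e j x -> e j y -> mdist x y <= gamma * s
    & forall x, exists g : nat -> set X, forall j,
        (exists2 z, e j z & mdist x z <= s / 2) ->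
        exists2 i, (i < n.+1)%N & g i = e j].
Proof.
move=> /cover_near_members[C [covC diamC nearC]].
have [Bp CBp Bpp] := covC p.
have /pfcard_geP[C0|[f]] := countable_members nearC.
  by have : [set B | C B /\ B !=set0] Bp by [split => //; exists p]; rewrite C0.
have memf j : [set B | C B /\ B !=set0] (f j) by exact: funS.
pose e j := if j is i.+1 then f i else Bp.
have Ce j : C (e j) by case: j => [//|i]; have [] := memf i.
exists e; split => //.
- move=> x; have [B CB Bx] := covC x.
  have [|i _ fi] := @surj _ _ _ _ f B; first by split => //; exists x.
  by exists i.+1; rewrite /= fi.
- by case=> [|i] /=; [exists p|case: (memf i)].
- by move=> j x y; exact: diamC.
move=> x; have /pfcard_geP[N0|[g]] := nearC x.
  exists e => j ej; have : near_members C x (e j) by split.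
  by rewrite N0.
exists g => j ej; have [|i ? gi] := @surj _ _ _ _ g (e j); first by split.
by exists i.
Qed.

End cover_enumeration.

(** * The uniform random parameter *)

Definition U01 (R : realType) : probability (measurableTypeR R) R :=
  uniform_prob (@ltr01 R).
Arguments U01 {R}.

Lemma U01E (R : realType) (A : set (measurableTypeR R)) : measurable A ->
  U01 A = lebesgue_measure (A `&` `[0, 1]).
Proof.
move=> mA; rewrite /U01 /= /uniform_prob integral_uniform_pdf.
transitivity (\int[lebesgue_measure]_(x in A `&` `[0%R, 1%R]) cst (1%:E : \bar R) x)%E.
  apply: eq_integral => x /set_mem[_ /=]; rewrite in_itv/= /uniform_pdf => ->.
  by rewrite subr0 invr1.
by rewrite integral_cst ?mul1e//; exact: measurableI.
Qed.

Lemma ae_U01 (R : realType) (Q : R -> Prop) :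
  (forall t, 0 < t <= 1 -> Q t) -> {ae @U01 R, forall t, Q t}.
Proof.
move=> HQ; exists (~` `]0, 1]); split.
- by apply: measurableC.
- rewrite U01E; last exact: measurableC.
  rewrite (_ : _ `&` _ = [set 0 : R]); first by rewrite lebesgue_measure_set1.
  apply/seteqP; split => t /=; rewrite !in_itv/=.
    case=> + /andP[t0 t1]; rewrite t1 andbT => /negP; rewrite -leNgt => t0'.
    by apply/eqP; rewrite eq_le t0' t0.
  by move=> ->; rewrite ltxx lexx ler01.
move=> t /= nQ; apply: contra_not nQ; rewrite in_itv/=; exact: HQ.
Qed.

(** * Random partition at one scale *)

Section threshold_labels.
Context (R : realType) (X : metricType R) (n : nat) (gamma s : R) (p : X).
Hypotheses (s0 : 0 < s).
Variable e : nat -> set X.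
Hypotheses (cov_e : forall x, exists j, e j x) (e0p : e 0%N p)
  (e_neq0 : forall j, e j !=set0)
  (diam_e : forall j x y, e j x -> e j y -> mdist x y <= gamma * s)
  (near_e : forall x, exists g : nat -> set X, forall j,
        (exists2 z, e j z & mdist x z <= s / 2) ->
        exists2 i, (i < n.+1)%N & g i = e j).

Let h := s / 2.
Let h0 : 0 < h. Proof. by rewrite divr_gt0. Qed.

Definition in_hull (x : X) (j : nat) (t : R) : bool := set_dist (e j) x < t * h.

Definition label (t : R) (x : X) : nat := first_index (fun j => in_hull x j t).

Lemma set_dist_in j x : e j x -> set_dist (e j) x <= 0.
Proof. by move=> ejx; rewrite -(mdistxx x); exact: set_dist_le. Qed.

Lemma in_hull_member t x j : 0 < t -> e j x -> in_hull x j t.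
Proof.
by move=> t0 /set_dist_in ejx; apply: le_lt_trans ejx _; rewrite mulr_gt0.
Qed.

Lemma in_hull_near t x j : t <= 1 -> in_hull x j t ->
  exists2 z, e j z & mdist x z <= s / 2.
Proof.
move=> t1 /(set_dist_lt (e_neq0 j))[z ez xz]; exists z => //.
by apply: le_trans (ltW xz) _; rewrite ler_piMl// ltW.
Qed.

Lemma label_base t : 0 < t -> label t p = 0%N.
Proof.
move=> t0; apply/eqP; rewrite -leqn0.
apply: (@first_index_min (fun j => in_hull p j t)); exact: in_hull_member.
Qed.

Lemma label_diam t x y : 0 < t <= 1 -> label t x = label t y ->
  mdist x y <= (gamma + 1) * s.
Proof.
move=> /andP[t0 t1] lxy.
have inlabel z : in_hull z (label t z) t.
  have [j ejz] := cov_e z.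
  apply: (@first_indexP (fun j => in_hull z j t) j); exact: in_hull_member.
have [u eu xu] := in_hull_near t1 (inlabel x).
have [v ev yv] := in_hull_near t1 (inlabel y).
rewrite -lxy in ev; have uv := diam_e eu ev.
have := metric_triangle x u y; have := metric_triangle u v y.
by rewrite (metric_sym v y); lra.
Qed.

Lemma measurable_label x j : measurable [set t : measurableTypeR R | label t x = j].
Proof.
apply: (@measurable_first_index _ _ (in_hull x)) => i.
rewrite (_ : [set w | _] = `](set_dist (e i) x / h), +oo[%classic);
  first exact: measurable_itv.
by apply/seteqP; split => t /=; rewrite in_itv/= andbT ltr_pdivrMr.
Qed.

Lemma measurable_label_neq x y :
  measurable [set t : measurableTypeR R | label t x != label t y].
Proof.
rewrite (_ : [set t | _] = \bigcup_j
   ([set t | label t x = j] `&` ~` [set t | label t y = j])).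
  apply: bigcupT_measurable => j; apply: measurableI; first exact: measurable_label.
  by apply: measurableC; exact: measurable_label.
apply/seteqP; split => t /=.
  by move=> /eqP lxy; exists (label t x) => //; split => // /esym.
by case=> j _ [/= <-] /eqP; rewrite eq_sym.
Qed.

(** If C_j catches x and misses y, then t lies in an interval with end points
    d(x, C_j) / (s / 2) and d(y, C_j) / (s / 2), of length at most
    d(x, y) / (s / 2) because d(-, C_j) is 1-Lipschitz.  Only the n + 1 members
    near x can catch x, which gives the union bound. *)
Lemma one_sided_cut x y : exists A : set (measurableTypeR R),
  [/\ measurable A,
      (lebesgue_measure A <= (2 * n.+1%:R * mdist x y / s)%:E)%E
    & forall j t, t <= 1 -> in_hull x j t -> ~~ in_hull y j t -> A t].
Proof.
have [g gP] := near_e x.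
(* The family g may contain the empty set, whose distance function is a junk
   value and not the distance to any point. *)
pose I i : set (measurableTypeR R) :=
  if `[< g i !=set0 >] then `](set_dist (g i) x / h), (set_dist (g i) y / h)]%classic
  else set0.
have mI i : measurable (I i) by rewrite /I; case: ifP => // _; exact: measurable_itv.
exists (\big[setU/set0]_(i < n.+1) I i); split.
- exact: bigsetU_measurable.
- apply: le_trans (Boole_inequality _ _) _; first by move=> i _; exact: mI.
  rewrite (_ : 2 * _ * _ / s = \sum_(i < n.+1) mdist x y / h); last first.
    by rewrite sumr_const card_ord /h -mulr_natr; field; rewrite gt_eqF.
  rewrite -sumEFin; apply: lee_sum => i _; rewrite /I.
  have d0 : 0 <= mdist x y / h by rewrite divr_ge0 ?mdist_ge0// ltW.
  case: ifPn => [/asboolP gi0|_]; last by rewrite measure0 lee_fin.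
  rewrite [X in (X <= _)%E](lebesgue_measure_itv
    `](set_dist (g i) x / h), (set_dist (g i) y / h)])/=; case: ifPn => // _.
  rewrite -EFinD lee_fin -mulrBl ler_pM2r ?invr_gt0// lerBlDl.
  exact: set_dist_lip.
move=> j t t1 xt yt; have [i iN gi] := gP j (in_hull_near t1 xt).
rewrite -(bigcup_mkord n.+1 I); exists i => //.
rewrite /I asboolT gi; last exact: e_neq0.
rewrite /= in_itv/= ltr_pdivrMr// ler_pdivlMr//.
by move: xt yt; rewrite /in_hull -leNgt => -> ->.
Qed.

(** Labels are a function of the family of catching members, so different labels
    require a member catching exactly one of x and y. *)
Lemma label_cut x y :
  (U01 [set t : measurableTypeR R | label t x != label t y] <=
   (4 * n.+1%:R * mdist x y / s)%:E)%E.
Proof.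
have [A [mA muA HA]] := one_sided_cut x y.
have [B [mB muB HB]] := one_sided_cut y x.
rewrite U01E; last exact: measurable_label_neq.
apply: (@le_trans _ _ (lebesgue_measure (A `|` B))).
  apply: le_measure; rewrite ?inE.
  - by apply: measurableI => //; exact: measurable_label_neq.
  - exact: measurableU.
  move=> t [/= lxy]; rewrite in_itv/= => /andP[_ t1].
  have [//|nAB] := pselect ((A `|` B) t).
  case/eqP: lxy; congr first_index; apply/funext => j.
  apply/idP/idP => [xt|yt]; apply/negPn/negP => nt; apply: nAB.
    by left; apply: HA xt nt.
  by right; apply: HB yt nt.
apply: le_trans (measureU2 _ _ _) _ => //.
apply: le_trans (leeD muA muB) _.
by rewrite -EFinD lee_fin (metric_sym y x) -mulrDl -!mulrDl -natrD.
Qed.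

End threshold_labels.

Lemma random_partition (R : realType) (X : metricType R) (n : nat)
    (gamma s : R) (p : X) :
  0 < s -> separable_space X -> nagata_dimension X n gamma ->
  exists l : R -> X -> nat,
  [/\ forall x j, measurable [set t : measurableTypeR R | l t x = j],
      forall x y, measurable [set t : measurableTypeR R | l t x != l t y],
      forall t, 0 < t <= 1 -> l t p = 0%N,
      forall t x y, 0 < t <= 1 -> l t x = l t y -> mdist x y <= (gamma + 1) * s
    & forall x y,
        (U01 [set t : measurableTypeR R | l t x != l t y] <=
         (4 * n.+1%:R * mdist x y / s)%:E)%E].
Proof.
move=> s0 sepX /(cover_enumeration p s0 sepX).
move=> [e [cov_e e0p e_neq0 diam_e near_e]].
exists (label s e); split.
- exact: measurable_label.
- exact: measurable_label_neq.
- by move=> t /andP[t0 _]; exact: label_base.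
- exact: label_diam.
- exact: label_cut.
Qed.

(** * Expectation of a first-difference distance *)

(** The integral of a nonnegative function is a supremum over the simple functions
    below it, hence monotone even when f or g fails to be measurable. *)
Lemma integral_le_of_le (d : measure_display) (T : measurableType d) (R : realType)
    (mu : {measure set T -> \bar R}) (f g : T -> \bar R) :
  (forall x, 0 <= f x)%E -> (forall x, f x <= g x)%E ->
  (\int[mu]_x f x <= \int[mu]_x g x)%E.
Proof.
move=> f0 fg; have g0 x : (0 <= g x)%E by exact: le_trans (fg x).
rewrite !ge0_integralTE//; apply: le_ereal_sup => _ [h hf <-].
by exists h => // x; exact: le_trans (fg x).
Qed.

(** A function that is at most c, except on events S k where it may reach a k, is
    dominated by c plus the sum of the a k times the indicators of the S k. *)
Lemma expectation_first_scale (d : measure_display) (T : measurableType d)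
    (R : realType) (P : probability T R) (f : T -> R) (c : R) (a p : nat -> R)
    (S : nat -> set T) (K : nat) :
  0 <= c -> (forall k, 0 <= a k) -> (forall w, 0 <= f w) ->
  (forall k, measurable (S k)) ->
  (forall k, P (S k) <= (p k)%:E)%E ->
  (forall w, f w <= c \/ exists2 k, (k < K)%N & S k w /\ f w <= a k) ->
  ('E_P[f] <= (c + \sum_(k < K) a k * p k)%:E)%E.
Proof.
move=> c0 a0 f0 mS PS fS; rewrite unlock.
have m1 k : measurable_fun [set: T] (EFin \o (\1_(S k) : T -> R)).
  exact/measurable_EFinP/measurable_indic.
have mk k : measurable_fun [set: T]
    ((fun w => (a k)%:E * (\1_(S k) w)%:E)%E : T -> \bar R).
  exact: measurable_funeM (m1 k).
have t0 k w : (0 <= (a k)%:E * (\1_(S k) w)%:E)%E by rewrite mule_ge0 ?lee_fin.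
apply: (@le_trans _ _ (\int[P]_w (cst c%:E w +
    \sum_(k < K) (a k)%:E * (\1_(S k) w)%:E)))%E.
  apply: integral_le_of_le => w; first by rewrite lee_fin.
  have [fc|[k kK [Sk fk]]] := fS w.
    by apply: le_trans (leeDl _ _); [rewrite lee_fin|exact: sume_ge0].
  apply: le_trans (leeDr _ _); last by rewrite lee_fin.
  rewrite (bigD1 (Ordinal kK))//= indicE mem_set// mule1.
  by apply: le_trans (leeDl _ _); [rewrite lee_fin|exact: sume_ge0].
rewrite ge0_integralD//; last 2 first.
  - by move=> w _; exact: sume_ge0.
  - exact: emeasurable_sum.
rewrite integral_cst//.
rewrite [X in (_ * X)%E](_ : _ = 1%E); last exact: probability_setT.
rewrite mule1 EFinD leeD2l//.
rewrite ge0_integral_sum// -sumEFin; apply: lee_sum => k _.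
rewrite ge0_integralZl//; last 2 first.
  - exact: m1.
  - by rewrite lee_fin.
rewrite integral_indic// setIT EFinM lee_wpmul2l ?lee_fin//; exact: PS.
Qed.

(** * Geometric estimates *)

Lemma half_powR (R : realType) (alpha : R) : 0 < alpha < 1 ->
  let b := 2^-1 `^ alpha in
  [/\ 0 < b < 1, 1 < 2 * b & forall k, (2^-1 ^+ k) `^ alpha = b ^+ k].
Proof.
move=> /andP[a0 a1] b.
have lt1 (r : R) : 0 < r -> 2^-1 `^ r < (1 : R).
  move=> r0; have {2}<- : 1 `^ r = (1 : R) by rewrite powR1.
  apply: gt0_ltr_powR; rewrite ?nnegrE//.
  by rewrite invf_lt1// ?ltr1n.
have b0 : 0 < b by rewrite powR_gt0.
split; first by rewrite b0 lt1.
  rewrite -ltr_pdivrMl// mulr1.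
  have {1}-> : (2^-1 : R) = b * 2^-1 `^ (1 - alpha).
    rewrite -powRD; last by apply/implyP => _; rewrite invr_neq0.
    by rewrite addrC subrK powRr1.
  by rewrite gtr_pMr// lt1// subr_gt0.
elim=> [|k IH]; first by rewrite !expr0 powR1.
by rewrite !exprS powRM ?IH// exprn_ge0.
Qed.

Lemma geometric_sum_le (R : realFieldType) (q : R) (K : nat) : 1 < q ->
  \sum_(k < K) q ^+ k <= q ^+ K / (q - 1).
Proof.
move=> q1; rewrite ler_pdivlMr ?subr_gt0// mulrC -subrX1.
by rewrite lerBlDr lerDl.
Qed.

Lemma dyadic_scale (R : realType) (delta r : R) : 0 < r <= delta ->
  exists m, delta * 2^-1 ^+ m.+1 < r <= delta * 2^-1 ^+ m.
Proof.
move=> /andP[r0 rdelta]; have d0 : 0 < delta by exact: lt_le_trans rdelta.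
have h01 : 0 < (2^-1 : R) < 1 by lra.
have ex : exists k, delta * 2^-1 ^+ k < r.
  have [k hk] := expr_lt_eps h01 (divr_gt0 r0 d0).
  by exists k; rewrite mulrC -ltr_pdivlMr.
case: (ex_minnP ex) => -[|m] mr minm.
  by move: mr; rewrite expr0 mulr1 ltNge rdelta.
exists m; rewrite mr /= leNgt; apply/negP => /minm; by rewrite ltnn.
Qed.

Section distortion_constant.
Context (R : realType) (n : nat) (gamma alpha : R).

Definition half_pow : R := 2^-1 `^ alpha.
(** Clusters at scale s have diameter at most mesh * s, so the scales are taken
    to be delta / mesh * 2^-k: clusters at level k then have diameter at most
    delta * 2^-k.  The absolute value keeps mesh positive for every gamma. *)
Definition mesh : R := `|gamma| + 1.
(** The factor in parentheses comes from the geometric sum of ratio 2 * half_pow;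
    half_pow^-1 is the ratio of the image distances attached to the two
    consecutive scales that enclose a given distance. *)
Definition distortion : R :=
  half_pow^-1 * (1 + 2 * (4 * n.+1%:R * mesh) / (2 * half_pow - 1)).
End distortion_constant.

Section bounds.
Context (R : realType) (n : nat) (gamma alpha delta : R).
Hypotheses (halpha : 0 < alpha < 1) (delta0 : 0 < delta).
Let b := half_pow alpha.
Let g := mesh gamma.
Let M : R := 4 * n.+1%:R * g.

(** The ratio 2 * b > 1 makes the sum at most a constant multiple of
    r / delta * (2 * b) ^+ m.+1; since r / delta is at most 2 * 2^-(m + 1), the powers
    of 2 cancel and b ^+ m.+1 remains. *)
Lemma upper_estimate (r : R) (m : nat) :
  delta * 2^-1 ^+ m.+1 < r <= delta * 2^-1 ^+ m ->
  b ^+ m.+1 + \sum_(k < m.+1) b ^+ k * (4 * n.+1%:R * r / (delta / g * 2^-1 ^+ k))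
  <= b * delta `^ (- alpha) * distortion n gamma alpha * r `^ alpha.
Proof.
move=> /andP[mr rm]; have [/andP[b0 b1] b2 bk] := half_powR halpha.
rewrite -/b in b0 b1 b2 bk.
have g0 : 0 < g by rewrite ltr_wpDl.
have r0 : 0 < r by apply: lt_trans mr; rewrite mulr_gt0// exprn_gt0// invr_gt0.
have M0 : 0 <= M by rewrite !mulr_ge0// ltW.
have q0 : 0 < 2 * b - 1 by rewrite subr_gt0.
have -> : \sum_(k < m.+1) b ^+ k * (4 * n.+1%:R * r / (delta / g * 2^-1 ^+ k)) =
    M * (r / delta) * \sum_(k < m.+1) (2 * b) ^+ k.
  rewrite mulr_sumr; apply: eq_bigr => k _; rewrite /M exprMn exprVn.
  by field; rewrite !gt_eqF.
have rd : r / delta <= 2 * 2^-1 ^+ m.+1.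
  by rewrite exprS mulVKf ?ler_pdivrMr// 1?mulrC.
have S1 : M * (r / delta) * \sum_(k < m.+1) (2 * b) ^+ k <=
    b ^+ m.+1 * (2 * M / (2 * b - 1)).
  apply: (@le_trans _ _ (M * (2 * 2^-1 ^+ m.+1) * ((2 * b) ^+ m.+1 / (2 * b - 1)))).
    apply: ler_pM; first by rewrite mulr_ge0// divr_ge0 ?ltW.
    - by apply: sumr_ge0 => k _; rewrite exprn_ge0// mulr_ge0// ltW.
    - by rewrite ler_wpM2l.
    exact: geometric_sum_le.
  rewrite exprMn le_eqVlt; apply/orP; left; apply/eqP.
  rewrite exprVn; field; by rewrite gt_eqF// expf_neq0.
have bm : b ^+ m.+1 <= delta `^ (- alpha) * r `^ alpha.
  rewrite -bk powRN [leRHS]mulrC ler_pdivlMr ?powR_gt0// [leLHS]mulrC.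
  rewrite -powRM ?exprn_ge0 ?invr_ge0 ?(ltW delta0)//.
  case/andP: halpha => a0 _; apply: ge0_ler_powR; rewrite ?nnegrE ?(ltW a0) ?(ltW r0)//.
    by rewrite mulr_ge0 ?exprn_ge0 ?invr_ge0 ?(ltW delta0).
  exact: ltW.
apply: (@le_trans _ _ (b ^+ m.+1 * (1 + 2 * M / (2 * b - 1)))).
  by rewrite mulrDr mulr1 lerD2l.
rewrite /distortion -/b -/g -/M.
have -> : b * delta `^ (- alpha) * (b^-1 * (1 + 2 * M / (2 * b - 1))) * r `^ alpha =
   delta `^ (- alpha) * r `^ alpha * (1 + 2 * M / (2 * b - 1)).
  by field; rewrite !gt_eqF.
by rewrite ler_wpM2r// addr_ge0// divr_ge0 ?mulr_ge0// ltW.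
Qed.

Lemma lower_estimate (r : R) (m : nat) :
  0 <= r <= delta * 2^-1 ^+ m ->
  b * delta `^ (- alpha) * r `^ alpha <= b ^+ m.+1.
Proof.
move=> /andP[r0 rm]; have [/andP[b0 b1] b2 bk] := half_powR halpha.
rewrite -/b in b0 b1 b2 bk.
rewrite exprS -mulrA ler_pM2l// powRN [leLHS]mulrC ler_pdivrMr ?powR_gt0// -bk [leRHS]mulrC.
rewrite -powRM ?exprn_ge0 ?invr_ge0 ?(ltW delta0)//.
case/andP: halpha => a0 _; apply: ge0_ler_powR; rewrite ?nnegrE ?(ltW a0)//.
by rewrite mulr_ge0 ?exprn_ge0 ?invr_ge0 ?(ltW delta0).
Qed.
End bounds.

Lemma bounded_spaceP (R : realType) (X : metricType R) : bounded_space X ->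
  exists2 delta : R, 0 < delta & forall x y : X, mdist x y <= delta.
Proof.
move=> bX; pose r := fine (diam [set: X]).
have dX0 : (0 <= diam [set: X])%E by apply: ereal_sup_ubound; left.
have rE : diam [set: X] = r%:E by rewrite fineK// ge0_fin_numE.
have r0 : 0 <= r by exact: fine_ge0.
exists (r + 1); first by rewrite ltr_wpDl.
move=> x y; have /(diam_le _ r0) dr : (diam [set: X] <= r%:E)%E by rewrite rE.
by apply: le_trans (dr x y _ _) _; rewrite ?inE// lerDl.
Qed.

(** * The embedding *)

Theorem theorem4p16 (R : realType) (n : nat) (gamma alpha : R)
    (halpha : 0 < alpha < 1) :
  exists D : R, forall (X : metricType R) (p : X),
    bounded_space X -> separable_space X -> nagata_dimension X n gamma ->
    exists (Y : metricType R) (y0 : Y),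
      [/\ bounded_space Y, separable_space Y, ultrametric Y
        & admits_stochastic_embedding (snowflake X halpha) p Y y0 D].
Proof.
exists (distortion n gamma alpha) => X p bX sX nX.
have [hb _ _] := half_powR halpha; rewrite -/(half_pow alpha) in hb.
set b := half_pow alpha in hb.
have [b0 b1] := andP hb.
have [delta delta0 Xdelta] := bounded_spaceP bX.
have g0 : 0 < mesh gamma by rewrite ltr_wpDl.
pose s k := delta / mesh gamma * 2^-1 ^+ k.
have s0 k : 0 < s k by rewrite mulr_gt0 ?divr_gt0// exprn_gt0// invr_gt0.
have [l lP] := choice (fun k => random_partition p (s0 k) sX nX).
have l_meas k x j := let: And5 H _ _ _ _ := lP k in H x j.
have l_cutmeas k x y := let: And5 _ H _ _ _ := lP k in H x y.
have l_base k t := let: And5 _ _ H _ _ := lP k in H t.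
have l_diam k t x y := let: And5 _ _ _ H _ := lP k in H t x y.
have l_cut k x y := let: And5 _ _ _ _ H := lP k in H x y.
exists (baire hb), (fun=> 0%N); split.
- exact: baire_bounded.
- exact: baire_separable.
- exact: baire_ultrametric.
pose phi (t : measurableTypeR R) (x : snowflake X halpha) : baire hb := fun k => l k t x.
exists _, (measurableTypeR R), U01, phi; split.
  split.
  - by move=> x B; apply: baire_borel_measurable => k j; exact: l_meas.
  - move=> x; exists setT, set0; split => //; first exact: baire_separable.
    exact: negligible_set0.
  by apply: ae_U01 => t t01; apply/funext => k; exact: l_base.
(* This scaling factor sends r^alpha below b ^+ m.+1 as soon as r is at most
   delta * 2^-m. *)
exists (b * delta `^ (- alpha)); first by rewrite mulr_gt0// powR_gt0.
move=> x y; rewrite snowflakeE.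
have [<-|xy] := eqVneq x y.
  rewrite mdistxx powR0 ?gt_eqF//; last by case/andP: (halpha).
  rewrite !mulr0; split.
    rewrite (_ : (fun w => _) = cst 0) ?expectation_cst//.
    by apply/funext => w; rewrite mdistxx.
  by apply: ae_U01 => t _; rewrite mdist_ge0.
have r0 : 0 < @mdist R X x y by rewrite (@mdist_gt0 R X).
have [m mP] : exists m, delta * 2^-1 ^+ m.+1 < @mdist R X x y <= delta * 2^-1 ^+ m.
  by apply: dyadic_scale; rewrite r0 Xdelta.
split.
  apply: (@le_trans _ _ (b ^+ m.+1 + \sum_(k < m.+1) b ^+ k *
       (4 * n.+1%:R * @mdist R X x y / s k))%:E); last first.
    by rewrite lee_fin; exact: upper_estimate.
  apply: (@expectation_first_scale _ _ _ _ _ (b ^+ m.+1) (fun k => b ^+ k)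
     (fun k => 4 * n.+1%:R * @mdist R X x y / s k)
     (fun k => [set t : measurableTypeR R | l k t x != l k t y])).
  - by rewrite exprn_ge0// ltW.
  - by move=> k; rewrite exprn_ge0// ltW.
  - by move=> w; exact: mdist_ge0.
  - by move=> k; exact: l_cutmeas.
  - by move=> k; exact: l_cut.
  (* Coordinates that first differ at level m.+1 or later contribute at most
     b ^+ m.+1; an earlier first difference at k forces the labels at
     level k to differ. *)
  move=> w; have [->|/eqP/baire_mdist_first_difference[k [neq ->]]] :=
    eqVneq (phi w x) (phi w y).
    by left; rewrite mdistxx exprn_ge0// ltW.
  have [km|mk] := ltnP k m.+1; first by right; exists k.
  by left; rewrite ler_wiXn2l// ltW.
apply: ae_U01 => t t01; have /andP[mr rm] := mP.
apply: (@le_trans _ _ (b ^+ m.+1)).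
  by apply: lower_estimate; rewrite // ltW.
(* A common label at level m.+1 would force the distance below its lower bound. *)
apply: baire_mdist_ge; apply/eqP => /(l_diam _ _ _ _ t01).
apply/negP; rewrite -ltNge; apply: le_lt_trans mr.
rewrite /s mulrA ler_pM2r ?exprn_gt0 ?invr_gt0//.
rewrite mulrCA ger_pMr// ler_pdivrMr// mul1r.
by rewrite lerD2r ler_norm.
Qed.
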